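(* Let $\mathcal{C}$ be a variety of finite groups, let $\mathbf{m}$ be an infinite cardinal, and let $G$ be a free pro-$\mathcal{C}$ group of rank $\mathbf{m}$. Let $1\to K\to C\xrightarrow{\alpha} D\to 1$ be an exact sequence of finite groups with $C\in\mathcal{C}$ and $K\neq 1$, and let $\varphi:G\to D$ be a continuous epimorphism. Then there are $2^{2^{\mathbf{m}}}$ different abstract (not necessarily continuous) epimorphisms $\psi:G\to C$ satisfying $\alpha\circ\psi=\varphi$.
   Context: A variety of finite groups is a class of finite groups closed under taking subgroups, quotients and finite direct products. A pro-$\mathcal{C}$ group is an inverse limit of groups in $\mathcal{C}$. The free pro-$\mathcal{C}$ group of rank $\mathbf{m}$ is the free pro-$\mathcal{C}$ group on a set $X$ converging to $1$ with $|X|=\mathbf{m}$: it is a pro-$\mathcal{C}$ group $F$ with a continuous pointed map $i:X\cup\{\ast\}\to F$ from the one-point compactification of the discrete space $X$ (with $\ast\mapsto 1$), such that every continuous pointed map $f:X\cup\{\ast\}\to H$ to a pro-$\mathcal{C}$ group $H$ (with $\ast\mapsto 1$) factors as $f=\bar f\circ i$ for a unique continuous homomorphism $\bar f:F\to H$. *)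

(* Defs.v *)
From HB Require Import structures.
From mathcomp Require Import all_boot all_order all_fingroup.
From mathcomp Require Import all_classical.
From mathcomp Require Import topology.

Set Implicit Arguments.
Unset Strict Implicit.
Unset Printing Implicit Defensive.

Local Open Scope group_scope.

HB.mixin Record isTopologicalGroup G of monoid.Group G & Topological G := {
  mulg_continuous : continuous (fun z : G * G => z.1 * z.2) ;
  invg_continuous : continuous (fun x : G => x^-1)
}.

#[short(type="topGroupType")]
HB.structure Definition TopologicalGroup :=
  {G of isTopologicalGroup G & monoid.Group G & Topological G}.

Definition finite_group_class := forall gT : finGroupType, {group gT} -> Prop.

(* As usual for classes of groups, membership is invariant under isomorphism.
   The index type of a finite product may be empty, so the trivial group is
   always a member. *)
Record variety_of_finite_groups (V : finite_group_class) : Prop := {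
  variety_isog : forall (gT rT : finGroupType)
      (G : {group gT}) (H : {group rT}),
    G \isog H -> V gT G -> V rT H ;
  variety_subgroup : forall (gT : finGroupType) (G H : {group gT}),
    H \subset G -> V gT G -> V gT H ;
  variety_quotient : forall (gT : finGroupType) (G H : {group gT}),
    H <| G -> V gT G -> V (coset_of H) (G / H)%G ;
  variety_product : forall (I : finType) (gT : I -> finGroupType)
      (G : forall i, {group gT i}),
    (forall i, V (gT i) (G i)) ->
    V {dffun forall i, gT i} (setXn_group G)
}.

(* Inverse systems of finite groups over a nonempty directed poset. *)
Record inverse_system d (I : porderType d) := InverseSystem {
  sys_group : I -> finGroupType ;
  sys_map : forall i j : I,
    (i <= j)%O -> {morphism [set: sys_group j] >-> sys_group i} ;
  sys_inhabited : inhabited I ;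
  sys_directed : forall i j : I, exists2 k : I, (i <= k)%O & (j <= k)%O ;
  sys_map_id : forall (i : I) (ii : (i <= i)%O) (x : sys_group i),
    sys_map ii x = x ;
  sys_map_comp : forall (i j k : I)
      (ij : (i <= j)%O) (jk : (j <= k)%O) (ik : (i <= k)%O) (x : sys_group k),
    sys_map ij (sys_map jk x) = sys_map ik x
}.

Definition sys_product d (I : porderType d) (S : inverse_system I) :=
  prod_topology (fun i : I => discrete_topology (sys_group S i)).

Definition sys_limit d (I : porderType d) (S : inverse_system I) :
    set (sys_product S) :=
  [set x | forall (i j : I) (ij : (i <= j)%O), sys_map S ij (x j) = x i]%classic.
Arguments sys_limit {d I} S.

(* [p] is an isomorphism of topological groups from [G] onto [sys_limit S],
   the latter with pointwise multiplication and the subspace topology. *)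
Definition is_inverse_limit d (I : porderType d) (S : inverse_system I)
    (G : topGroupType) (p : G -> sys_product S) : Prop :=
  [/\ forall (i : I) (x y : G),
        p (x * y) i = (p x i : sys_group S i) * (p y i : sys_group S i),
      injective p,
      range p = sys_limit S
    & forall U : set G, open U <->
        exists2 W : set (sys_product S), open W & (p @^-1` W)%classic = U].

Definition pro (V : finite_group_class) (G : topGroupType) : Prop :=
  exists (d : Order.disp_t) (I : porderType d) (S : inverse_system I),
    (forall i, V (sys_group S i) [set: sys_group S i]%G) /\
    exists p : G -> sys_product S, is_inverse_limit p.

(* The point at infinity of the one-point compactification is [None]. *)
Definition is_free_pro_on (V : finite_group_class) (X : choiceType)
    (F : topGroupType)
    (i : one_point_compactification (discrete_topology X) -> F) : Prop :=
  [/\ pro V F, continuous i, i None = 1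
    & forall (H : topGroupType)
        (f : one_point_compactification (discrete_topology X) -> H),
        pro V H -> continuous f -> f None = 1 ->
        exists! fbar : F -> H,
          [/\ {morph fbar : x y / x * y}, continuous fbar & f = fbar \o i]].

(* Cardinals are represented by types: [M] stands for its cardinality. *)
Definition is_free_pro_of_rank (V : finite_group_class) (M : Type)
    (F : topGroupType) : Prop :=
  exists2 X : choiceType, ([set: X] #= [set: M])%classic%card &
    exists i : one_point_compactification (discrete_topology X) -> F,
      is_free_pro_on V i.

(* Main.v *)
Require Import Defs.
From HB Require Import structures.
From mathcomp Require Import all_boot all_order all_fingroup.
From mathcomp Require Import all_classical.
From mathcomp Require Import topology.

(* Fix a nontrivial k in ker alpha and let X, of cardinality m, be the basis
   of G. For each t in an index set T of cardinality m, freeness gives a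
   continuous lift theta_t : G -> C of phi with theta_t(x) = c_x for all t
   on a finite part of X, where the c_x exhaust ker alpha, and theta_t(x_s)
   = k or 1 according to whether s = t or not, for a family (x_s) of basis
   elements in the kernel of phi. For an ultrafilter U on T, the pointwise
   limit of (theta_t) along U is an epimorphism psi_U lifting phi. By
   compactness every A <= T has a g_A in G with theta_t(g_A) = k for t in A
   and 1 otherwise, so that psi_U(g_A) = k iff A is in U: distinct
   ultrafilters give distinct lifts. An independent family of 2^m subsets of
   T yields 2^(2^m) ultrafilters.

   Conversely |G| <= 2^m: a continuous homomorphism from G to a finite group
   is determined by its finitely many nontrivial values on X, so there are
   only m of them up to isomorphism, and they separate the points of G. *)

Set Implicit Arguments.
Unset Strict Implicit.
Unset Printing Implicit Defensive.

Local Open Scope group_scope.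
Local Open Scope classical_set_scope.
Local Open Scope card_scope.

(** * Cardinal arithmetic *)

Lemma card_leTP (T U : Type) :
  [set: T] #<= [set: U] <-> exists f : T -> U, injective f.
Proof.
split=> [/card_leP[f]|[f fI]].
  exists (fun x => val (f (SigSub (mem_set (I : setT x))))) => x y /val_inj.
  by move=> /inj; rewrite !in_setT => /(_ isT isT) [].
have /injfunPex[g] : exists2 f : T -> U, set_fun setT setT f & set_inj setT f.
  by exists f => // x y _ _; exact: fI.
exact: inj_card_le.
Qed.

(* A maximal partial injection is total or onto. *)
Lemma card_le_total (T U : Type) (A : set T) (B : set U) :
  A #<= B \/ B #<= A.
Proof.
elim/Ppointed: T => T in A *; first by left; rewrite !emptyE.
elim/Ppointed: U => U in B *; first by right; rewrite !emptyE.
pose P (G : set (T * U)) := (forall p, G p -> A p.1 /\ B p.2) /\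
  (forall p q, G p -> G q -> p.1 = q.1 <-> p.2 = q.2).
have [F FP Ftot|G [[GAB Ginj] Gmax]] := @Zorn_bigcup _ P.
  split=> [p [G FG Gp]|p q [G FG Gp] [H FH Hq]]; first exact: (FP _ FG).1.
  have [GH|HG] := Ftot _ _ FG FH.
    by apply: (FP _ FH).2 => //; exact: GH.
  by apply: (FP _ FG).2 => //; exact: HG.
have [/choice[f fG]|nA] := pselect (forall t, exists u, A t -> G (t, u)).
  left; apply/pcard_leP/injfunPex; exists f => [t /fG/GAB[]//|].
  move=> t t' /set_mem/fG Gt /set_mem/fG Gt' ftt'.
  exact/(Ginj _ _ Gt Gt').
have [/choice[f fG]|nB] := pselect (forall u, exists t, B u -> G (t, u)).
  right; apply/pcard_leP/injfunPex; exists f => [t /fG/GAB[]//|].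
  move=> t t' /set_mem/fG Gt /set_mem/fG Gt' ftt'.
  exact/(Ginj _ _ Gt Gt').
(* A point [t] outside the domain and a point [u] outside the image would extend [G] by [(t, u)]. *)
have /existsNP[t /forallNP nt] := nA; have /existsNP[u /forallNP nu] := nB.
have {nt} [At nt] : A t /\ forall v, ~ G (t, v).
  by split=> [|v]; [have /not_implyP[] := nt u | have /not_implyP[] := nt v].
have {nu} [Bu nu] : B u /\ forall v, ~ G (v, u).
  by split=> [|v]; [have /not_implyP[] := nu t | have /not_implyP[] := nu v].
exfalso; apply: (Gmax (G `|` [set (t, u)])).
  by split=> [p Gp|/(_ (t, u) (or_intror erefl))]; [left|exact: nt].
split=> [p [/GAB//|->//]|[a b] [c d]] [Gp|[-> ->]] [Gq|[-> ->]] //=.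
- exact: (Ginj _ _ Gp Gq).
- by split=> E; exfalso; [apply: (nt b)|apply: (nu a)]; rewrite -E.
- by split=> E; exfalso; [apply: (nt d)|apply: (nu c)]; rewrite E.
Qed.

(* A maximal injection of a square A * A into A, with A infinite, has
   A equipotent to T: otherwise ~` A contains a copy h A of A, and the
   injection extends to the square of A `|` h A by sending the new pairs
   into h A. *)
Lemma card_setX_self (T : Type) :
  infinite_set [set: T] -> [set: T * T] #<= [set: T].
Proof.
elim/Ppointed: T => T.
  by move=> _; apply/card_leTP; exists fst => -[x]; have := no x.
move=> /infiniteP/card_leTP[v vI].
(* A [good] set is the graph of an injection from the square of [dom G] into [dom G], the domain
   being read off the diagonal. *)
pose dom (G : set (T * T * T)) : set T := fun x => exists z, G (x, x, z).
pose good G := [/\ forall p q, G p -> G q -> p.1 = q.1 <-> p.2 = q.2,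
  forall x y z, G (x, y, z) -> [/\ dom G x, dom G y & dom G z] &
  forall x y, dom G x -> dom G y -> exists z, G (x, y, z)].
(* A pairing on a copy of [nat], kept in every graph so that [A] below contains the distinct tags
   [v 0] and [v 1]. *)
pose G0 := [set p : T * T * T | exists m n : nat,
  p = (v m, v n, v (pickle (m, n)))].
have domG0 m : dom G0 (v m) by exists (v (pickle (m, m))), m, m.
have goodG0 : good G0.
  split=> [_ _ [m [n ->]] [m' [n' ->]]|_ _ _ [m [n [-> -> ->]]]|x y].
  - split=> /= [[/vI-> /vI->]//|].
    by move=> /vI/(pcan_inj (@pickleK _))[-> ->].
  - by split; exact: domG0.
  - move=> [_ [m [_ [-> _ _]]]] [_ [n [_ [-> _ _]]]].
    by exists (v (pickle (m, n))), m, n.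
have [F FP Ftot|G [Ggood Gmax]] :=
    @Zorn_bigcup _ [set G | good (G `|` G0)].
  pose U := \bigcup_(X in F) X `|` G0.
  have common p q : U p -> U q ->
      exists D, [/\ good D, D `<=` U, D p & D q].
    have sub H : F H -> H `|` G0 `<=` U.
      by move=> FH; apply: setSU => x Hx; exists H.
    move=> [[H FH Hp]|p0] [[K FK Kq]|q0].
    - have [HK|KH] := Ftot _ _ FH FK.
        exists (K `|` G0); split;
          [exact: FP|exact: sub|left; exact: HK|by left].
      exists (H `|` G0); split; [exact: FP|exact: sub|by left|left; exact: KH].
    - exists (H `|` G0); split; [exact: FP|exact: sub|by left|by right].
    - exists (K `|` G0); split; [exact: FP|exact: sub|by right|by left].
    - by exists G0; split=> // x; right.
  have mono D D' : D `<=` D' -> dom D `<=` dom D'.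
    by move=> DD x [z /DD]; exists z.
  split=> [p q Up Uq|x y z Up|x y [a Ua] [b Ub]].
  - by have [D [[DI _ _] _ Dp Dq]] := common _ _ Up Uq; exact: DI.
  - have [D [[_ Ddom _] DU Dp _]] := common _ _ Up Up.
    by have [? ? ?] := Ddom _ _ _ Dp; split; exact: (mono _ _ DU).
  - have [D [[_ _ Dtot] DU Dp Dq]] := common _ _ Ua Ub.
    have [z Dz] : exists z, D (x, y, z) by apply: Dtot; [exists a|exists b].
    by exists z; exact: DU.
pose D := G `|` G0; pose A : set T := dom D.
have [DI Ddom Dtot] : good D := Ggood.
have Av n : A (v n) by have [z Gz] := domG0 n; exists z; right.
have /choice[f fP] : forall p : T * T, exists z, A p.1 -> A p.2 -> D (p, z).
  move=> [x y] /=; have [[Ax Ay]|nA] := pselect (A x /\ A y).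
    by have [z Dz] := Dtot _ _ Ax Ay; exists z.
  by exists x => Ax Ay; case: nA.
have fA x y : A x -> A y -> A (f (x, y)).
  by move=> Ax Ay; have [] := Ddom _ _ _ (fP (x, y) Ax Ay).
have fI x y x' y' : A x -> A y -> A x' -> A y' ->
    f (x, y) = f (x', y') -> x = x' /\ y = y'.
  move=> Ax Ay Ax' Ay' E.
  by have [_ /(_ E)[]] := DI _ _ (fP (x, y) Ax Ay) (fP (x', y') Ax' Ay').
(* If the complement of [A] is no larger than [A], tagging by [v 0] and [v 1] sends [T] into [A],
   where [f] is a pairing. *)
have [|] := card_le_total (~` A) A.
  move=> /pcard_leP/injfunPex[h hA hI].
  pose j x := if `[< A x >] then f (v 0%N, x) else f (v 1%N, h x).
  have jA x : A (j x).
    by rewrite /j; case: asboolP => [Ax|nAx]; apply: fA => //; exact: hA.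
  have v01 : v 0%N <> v 1%N by move/vI.
  have jI : injective j.
    move=> x y; rewrite /j; case: asboolP => Ax; case: asboolP => Ay.
    - by move=> /fI[].
    - by move=> /fI[]//; exact: hA.
    - by move=> /fI[]//; [exact: hA|move/esym].
    - move=> /fI[] //; [exact: hA|exact: hA|move=> _ /hI].
      by apply; exact/mem_set.
  apply/card_leTP; exists (fun p => f (j p.1, j p.2)) => -[x y] [x' y'] /=.
  by move=> /fI[]// /jI-> /jI->.
move=> /pcard_leP/injfunPex[h hA hI]; exfalso.
pose e (a : bool) x := if a then h x else x.
have eI a x b y : A x -> A y -> e a x = e b y -> a = b /\ x = y.
  move: a b => [] [] Ax Ay //= E.
  - by split=> //; apply: hI => //; exact/mem_set.
  - by have := hA _ Ax; rewrite E.
  - by have := hA _ Ay; rewrite -E.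
have eA a x : A x -> A (e a x) -> a = false.
  by case: a => // Ax; have := hA _ Ax.
(* Through the tags [w], [g] packs the copies and the preimages of both arguments into one element
   of [A], then moves it by [h] away from all old values. *)
pose w (a : bool) := v a; have Aw a : A (w a) by exact: Av.
have wI : injective w by move=> a b /vI; case: a b => [] [].
pose g a b x y := h (f (f (w a, w b), f (x, y))).
pose N := [set p : T * T * T | exists a b x y,
  [/\ a || b, A x, A y & p = (e a x, e b y, g a b x y)]].
have domE z : dom (D `|` N) z <-> exists a x, A x /\ z = e a x.
  split=> [[y [Dz|[a [_ [x [_ [_ Ax _ [-> _ _]]]]]]]]|[a [x [Ax ->]]]].
  - by exists false, z; split=> //; exists y.
  - by exists a, x.
  - case: a; last by have [y Dy] := Ax; exists y; left.
    by exists (g true true x x); right; exists true, true, x, x.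
have Ah a b x y : A x -> A y -> A (f (f (w a, w b), f (x, y))).
  by move=> Ax Ay; apply: (fA _ _ (fA _ _ (Aw a) (Aw b)) (fA _ _ Ax Ay)).
apply: (Gmax (G `|` N)).
  split=> [p Gp|NG]; first by left.
  have Nh : N (h (v 0%N), h (v 0%N), g true true (v 0%N) (v 0%N)).
    by exists true, true, (v 0%N), (v 0%N).
  suff : A (h (v 0%N)) by exact: hA.
  by eexists; left; apply: NG; right; exact: Nh.
rewrite /= setUAC -/D; split.
(* A new entry has an argument and its value outside [A], so it cannot clash with an old one. *)
- move=> p q [Dp|Np] [Dq|Nq]; first exact: DI.
  + move: p Dp Nq => [[s t] z] /Ddom[As At Az] [a [b [x [y [ab Ax Ay ->]]]]].
    split=> /= [[sE tE]|zE].
      exfalso; move: ab As At; rewrite sE tE => + /(eA _ _ Ax) a0.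
      by rewrite a0 => + /(eA _ _ Ay) b0; rewrite b0.
    by exfalso; move: Az; rewrite zE; apply: hA; exact: Ah.
  + move: q Dq Np => [[s t] z] /Ddom[As At Az] [a [b [x [y [ab Ax Ay ->]]]]].
    split=> /= [[sE tE]|zE].
      exfalso; move: ab As At; rewrite -sE -tE => + /(eA _ _ Ax) a0.
      by rewrite a0 => + /(eA _ _ Ay) b0; rewrite b0.
    by exfalso; move: Az; rewrite -zE; apply: hA; exact: Ah.
  + move: Np Nq => [a [b [x [y [ab Ax Ay ->]]]]].
    move=> [a' [b' [x' [y' [ab' Ax' Ay' ->]]]]] /=; split.
      by move=> [/eI[]// -> -> /eI[]// -> ->].
    move=> /(hI _ _ (mem_set (Ah _ _ _ _ Ax Ay))
                    (mem_set (Ah _ _ _ _ Ax' Ay'))).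
    move=> /fI[]; do ?exact: fA.
    by move=> /fI[]// /wI-> /wI-> /fI[]// -> ->.
- move=> x y z [/Ddom[Ax Ay Az]|[a [b [s [t [ab As At [-> -> ->]]]]]]].
    by split; apply/domE; [exists false, x|exists false, y|exists false, z].
  split; apply/domE; [by exists a, s|by exists b, t|].
  by exists true; eexists; split; [exact: (Ah a b _ _ As At)|].
- move=> x y /domE[a [s [As ->]]] /domE[b [t [At ->]]].
  have [ab|] := boolP (a || b).
    by exists (g a b s t); right; exists a, b, s, t.
  rewrite negb_or => /andP[/negbTE-> /negbTE->].
  by have [z Dz] := Dtot _ _ As At; exists z; left.
Qed.

Section InfiniteAbsorption.
Variables (X : Type) (Xinf : infinite_set [set: X]).

Lemma card_setX_le (T U : Type) : [set: T] #<= [set: X] ->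
  [set: U] #<= [set: X] -> [set: T * U] #<= [set: X].
Proof.
move=> /card_leTP[f fI] /card_leTP[g gI].
have /card_leTP[k kI] := card_setX_self Xinf.
apply/card_leTP; exists (fun p => k (f p.1, g p.2)) => -[a b] [c d] /=.
by move=> /kI[/fI-> /gI->].
Qed.

Lemma card_countType_le (T : countType) : [set: T] #<= [set: X].
Proof. exact: card_le_trans (countableP _) ((infiniteP _).1 Xinf). Qed.

Lemma card_seq_le (T : Type) :
  [set: T] #<= [set: X] -> [set: seq T] #<= [set: X].
Proof.
move=> /card_leTP[f fI]; have /card_leTP[k kI] := card_setX_self Xinf.
have /infiniteP/card_leTP[v _] := Xinf.
suff: [set: seq T] #<= [set: nat * X].
  move/card_le_trans; apply; apply: card_setX_le; last exact: card_lexx.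
  exact: card_countType_le.
(* The base [v 0] may itself code a nonempty sequence, so the length is recorded too. *)
pose enc := foldr (fun t x => k (f t, x)) (v 0%N).
apply/card_leTP; exists (fun s => (size s, enc s)).
elim=> [|t s IHs] [|t' s'] //= [ss' /kI[/fI->]] ess'.
by congr cons; apply: IHs; rewrite ss' ess'.
Qed.

End InfiniteAbsorption.

(** * Discrete groups, ultrafilters and compactness *)

HB.instance Definition _ (A : finGroupType) :=
  monoid.Group.copy (discrete_topology A) A.

Lemma discrete_continuous (T : topologicalType) (A : choiceType)
  (f : T -> discrete_topology A) :
  (forall a, open (f @^-1` [set a])) -> continuous f.
Proof.
move=> fo x; apply/discrete_cvg; apply: open_nbhs_nbhs; split=> //.
Qed.

Section DiscreteGroup.
Variable A : finGroupType.

Lemma discrete_mulg_continuous :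
  continuous (fun z : discrete_topology A * discrete_topology A => z.1 * z.2).
Proof.
move=> [x y]; apply/discrete_cvg => /=.
exists ([set x], [set y]); first by split; exact: discrete_set1.
by move=> [a b] /= [-> ->].
Qed.

Lemma discrete_invg_continuous :
  continuous (fun x : discrete_topology A => x^-1).
Proof.
move=> x; apply/discrete_cvg.
suff: nbhs x [set y | y^-1 = x^-1] by [].
by apply: (filterS _ (discrete_set1 x)) => _ ->.
Qed.

HB.instance Definition _ := isTopologicalGroup.Build (discrete_topology A)
  discrete_mulg_continuous discrete_invg_continuous.
End DiscreteGroup.

Lemma discrete_preimage_open (T : topologicalType) (A : choiceType)
    (f : T -> discrete_topology A) (W : set (discrete_topology A)) :
  continuous f -> open (f @^-1` W).
Proof.
by move=> fc; apply: open_comp; [move=> x _; exact: fc|exact: discrete_open].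
Qed.

(** Use the constant system over [bool]: [true] is a greatest index, so a thread is determined by
    its coordinate there. *)
Lemma pro_discrete (V : finite_group_class) (A : finGroupType) :
  V A [set: A]%G -> pro V (discrete_topology A).
Proof.
move=> VA.
pose idm (i j : bool) (_ : (i <= j)%O) := idm_morphism [set: A].
have H1 : forall i j : bool, exists2 k : bool, (i <= k)%O & (j <= k)%O.
  by move=> i j; exists true => //; [case: i|case: j].
pose S := @InverseSystem _ bool (fun=> A) idm (inhabits true) H1
  (fun _ _ _ => erefl) (fun _ _ _ _ _ _ _ => erefl).
exists _, bool, S; split=> //.
exists (fun x _ => x); split=> //.
- by move=> x y /(congr1 (fun f : sys_product S => f true)).
- rewrite eqEsubset; split=> [_ [x _ <-] //|x /= xS].
  exists (x true) => //; apply/functional_extensionality_dep => -[] //.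
  exact: (xS false true isT).
- move=> U; split=> _; last exact: discrete_open.
  exists ((fun f : sys_product S => f true) @^-1` U) => //.
  apply: open_comp; last exact: discrete_open.
  by move=> x _; exact: (@proj_continuous bool (fun=> discrete_topology A)).
Qed.

(** In an infinite [K] the complements of finite sets generate a proper filter, without cluster
    point since singletons are open. *)
Lemma compact_discrete_finite (X : choiceType) (K : set (discrete_topology X)) :
  compact K -> finite_set K.
Proof.
move=> Kc; apply: contrapT => Kinf.
have FF : ProperFilter (filter_from finite_set (fun E => K `\` E)).
  apply: filter_from_proper => [|E Efin]; last first.
    exact/infinite_setN0/infinite_setD.
  apply: filter_from_filter => [|E E' Efin E'fin].
    by exists set0; exact: finite_set0.
  exists (E `|` E'); first by rewrite finite_setU.
  by rewrite setDUr.
have [|x [_ /(_ (K `\` [set x]) [set x])]] := Kc _ FF.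
  by exists set0 => //; rewrite setD0.
case; [by exists [set x]|exact: discrete_set1|].
by move=> y [[_ nyx]].
Qed.

(** Only the point at infinity matters, and its neighbourhoods are the cofinite sets containing
    it. *)
Lemma one_point_continuousP (X A : choiceType)
    (f : one_point_compactification (discrete_topology X) ->
         discrete_topology A) :
  continuous f <-> finite_set [set x | f (Some x) <> f None].
Proof.
split=> [fc|ffin].
  have /(_ _ (discrete_set1 _)) [K [Kc _] Kf] := fc None.
  apply: sub_finite_set (compact_discrete_finite Kc) => x fx.
  apply: contrapT => nKx; apply: fx.
  by apply: (Kf (Some x)); left; exists x.
have fF (y : one_point_compactification (discrete_topology X)) : Filter (f @ y).
  exact: (@fmap_filter _ _ f _ (nbhs_filter y)).
case=> [x|]; apply/discrete_cvg.
  suff: nbhs (x : discrete_topology X) [set y | f (Some y) = f (Some x)] by [].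
  by apply: (filterS _ (discrete_set1 x)) => _ ->.
suff: @one_point_nbhs (discrete_topology X) None [set y | f y = f None] by [].
exists [set x | f (Some x) <> f None].
  by split; [exact: finite_compact|exact: discrete_closed].
by move=> _ [[x /= /contrapT fx <-]|->].
Qed.

(** An ultrafilter missing every fiber would contain their finitely many complements, whose
    intersection is empty. *)
Lemma ultra_fiber (T : Type) (A : finType) (U : set_system T) (f : T -> A) :
  UltraFilter U -> exists a, U [set t | f t = a].
Proof.
move=> UU; apply: contrapT => /forallNP nU.
have : U (fun t => forall a, f t <> a).
  apply: filter_forall => a.
  by have [/nU|] := in_ultra_setVsetC [set t | f t = a] UU.
by move=> /filter_ex[t /(_ (f t))].
Qed.

Lemma finite_meet_ultra (I : eqType) (Y : Type) (P : I -> set Y) :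
  (forall s : seq I, exists y, forall i, i \in s -> P i y) ->
  exists U, UltraFilter U /\ forall i, U (P i).
Proof.
move=> Pfip; pose B (s : seq I) := [set y | forall i, i \in s -> P i y].
have BF : ProperFilter (filter_from setT B).
  apply: filter_from_proper => [|s _]; last exact: Pfip.
  apply: filter_fromT_filter => [|s t]; first by exists [::].
  by exists (s ++ t) => y By; split=> i si; apply: By; rewrite mem_cat si ?orbT.
have [U [UU BU]] := ultraFilterLemma BF.
exists U; split=> // i; apply: BU; exists [:: i] => // y; apply.
by rewrite mem_head.
Qed.

(** This is compactness of [G]: each coordinate is constant on a member of [U], and these constants
    form the limit. *)
Lemma pro_ultra_cvg (V : finite_group_class) (G : topGroupType)
    (U : set_system G) :
  pro V G -> UltraFilter U -> exists g : G, U --> g.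
Proof.
move=> [d [I [S [_ [p [pM pI pS pO]]]]]] UU.
have ex i : {a : sys_group S i | U [set g | p g i = a]}.
  by apply: cid; exact: (ultra_fiber (fun g => p g i : sys_group S i)).
pose c : sys_product S := fun i => projT1 (ex i).
have cP i : U [set g | p g i = c i] by rewrite /c; case: (ex i).
(* Coordinates [i] and [j] take their limit values at a common point, whose compatibility passes to
   [c]. *)
have [g _ gc] : range p c.
  rewrite pS => i j ij.
  have : U ([set g | p g j = c j] `&` [set g | p g i = c i]) by exact: filterI.
  move=> /filter_ex[g [<- <-]].
  have : sys_limit S (p g) by rewrite -pS; exists g.
  exact.
exists g => W; rewrite nbhsE => -[O [/pO[B Bo <-] Bg] BW].
apply: (filterS BW) => {W BW}.
have pc : p @ U --> (c : sys_product S).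
  apply/cvg_sup => i W; rewrite nbhsE => -[Q [[Q' Q'o <-] Q'c] QW].
  suff: U (p @^-1` W) by [].
  by apply: (filterS _ (cP i)) => h hi; apply: QW; rewrite /preimage /= hi.
by apply: pc; apply: open_nbhs_nbhs; split=> //; rewrite -gc.
Qed.

(** * Free pro-V groups *)

Lemma inverse_limit_proj_continuous d (I : porderType d)
    (S : inverse_system I) (G : topGroupType) (p : G -> sys_product S) (i : I) :
  is_inverse_limit p ->
  continuous (fun g => p g i : discrete_topology (sys_group S i)).
Proof.
move=> [_ _ _ pO]; apply: discrete_continuous => a; apply/pO.
exists ((fun f : sys_product S => f i) @^-1` [set a]) => //.
apply: open_comp; last exact: discrete_open.
move=> x _.
exact: (@proj_continuous _ (fun i => discrete_topology (sys_group S i))).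
Qed.

Lemma nat_enum_rank_inj (A : finType) :
  injective (fun a : A => enum_rank a : nat).
Proof. by move=> a b /ord_inj/enum_rank_inj. Qed.

(** Ranks in place of elements give groups on different carriers codes in one countable type,
    complete up to isomorphism. *)
Definition mul_table (A : finGroupType) : seq (nat * nat * nat) :=
  [seq (nat_of_ord (enum_rank a), nat_of_ord (enum_rank b),
        nat_of_ord (enum_rank (a * b))) | a <- enum A, b <- enum A].

Lemma mul_table_isom (A B : finGroupType) : mul_table A = mul_table B ->
  exists2 s : A -> B, {morph s : a b / a * b} &
    forall a, enum_rank (s a) = enum_rank a :> nat.
Proof.
move=> AB.
have tab (a b : A) : exists a' b' : B, [/\ enum_rank a' = enum_rank a :> nat,
    enum_rank b' = enum_rank b :> nat &
    enum_rank (a' * b') = enum_rank (a * b) :> nat].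
  have : (nat_of_ord (enum_rank a), nat_of_ord (enum_rank b),
          nat_of_ord (enum_rank (a * b))) \in mul_table A.
    by apply/allpairsP; exists (a, b); rewrite !mem_enum.
  rewrite AB => /allpairsP[[a' b'] [_ _ [-> -> ->]]].
  by exists a', b'.
have /choice[s sP] : forall a : A, exists b : B,
    enum_rank b = enum_rank a :> nat.
  by move=> a; have [b [_ [? _ _]]] := tab a a; exists b.
exists s => // a b; have [a' [b' [aa bb ab]]] := tab a b.
apply: nat_enum_rank_inj; rewrite sP -ab.
by congr (nat_of_ord (enum_rank (_ * _))); apply: nat_enum_rank_inj;
  rewrite sP.
Qed.

Lemma morph_mulg1 (G : groupType) (H : groupType) (f : G -> H) :
  {morph f : x y / x * y} -> f 1 = 1.
Proof. by move=> fM; apply: (mulgI (f 1)); rewrite -fM !mulg1. Qed.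

Section FreePro.
Variables (V : finite_group_class) (X : choiceType) (G : topGroupType).
Variable i : one_point_compactification (discrete_topology X) -> G.
Hypothesis iF : is_free_pro_on V i.

Let ic : continuous i. Proof. by case: iF. Qed.
Let i1 : i None = 1. Proof. by case: iF. Qed.

Section Target.
Variables (A : finGroupType) (VA : V [set: A]%G).

Lemma free_pro_finite_support (f : G -> discrete_topology A) :
  {morph f : x y / x * y} -> continuous f ->
  finite_set [set x | f (i (Some x)) <> 1].
Proof.
move=> fM fc; have /one_point_continuousP : continuous (f \o i).
  by move=> x; apply: continuous_comp; [exact: ic|exact: fc].
by rewrite /= i1 morph_mulg1.
Qed.

(** Finite support is continuity at infinity for the extension of [s] by 1. *)
Lemma free_pro_extend (s : X -> A) : finite_set [set x | s x <> 1] ->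
  exists f : G -> discrete_topology A, [/\ {morph f : x y / x * y},
    continuous f & forall x, f (i (Some x)) = s x].
Proof.
move=> sfin.
pose s' (x : one_point_compactification (discrete_topology X)) :
  discrete_topology A := if x is Some y then s y else 1.
have [_ _ _ /(_ _ s' (pro_discrete VA))] := iF.
move=> [||f [[fM fc sf] _]] //; first exact/one_point_continuousP.
by exists f; split=> // x; rewrite -[f _]/((f \o i) (Some x)) -sf.
Qed.

Lemma free_pro_unique (f g : G -> discrete_topology A) :
  {morph f : x y / x * y} -> continuous f ->
  {morph g : x y / x * y} -> continuous g ->
  (forall x, f (i (Some x)) = g (i (Some x))) -> f = g.
Proof.
move=> fM fc gM gc fg.
have fgi : f \o i = g \o i.
  by apply/funext => -[x|] /=; rewrite ?fg// i1 !morph_mulg1.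
have [_ _ _ /(_ _ (f \o i) (pro_discrete VA))] := iF.
case=> [||h [_ hu]].
- by move=> x; apply: continuous_comp; [exact: ic|exact: fc].
- by rewrite /= i1 morph_mulg1.
- by rewrite -(hu f) // -(hu g).
Qed.

End Target.

(** [I] may be arbitrarily large, but a code from a set no larger than [X] determines a projection
    up to isomorphism. A point is sent to the set of its coordinates, each tagged by its code. *)
Lemma card_free_pro_le : infinite_set [set: X] -> [set: G] #<= [set: set X].
Proof.
move=> Xinf; have [[d [I [S [VS [p pP]]]]] _ _ _] := iF.
have [pM pI _ _] := pP.
pose proj j g : discrete_topology (sys_group S j) := p g j.
have projM j : {morph proj j : x y / x * y} by move=> x y; exact: pM.
have projc j : continuous (proj j) by exact: inverse_limit_proj_continuous.
pose supp j := [set x : X | proj j (i (Some x)) <> 1].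
have /choice[L LP] : forall j, exists s : seq X, supp j = [set` s].
  by move=> j; apply/finite_seqP; exact: free_pro_finite_support.
pose rk j g : nat := enum_rank (proj j g : sys_group S j).
pose code j := (mul_table (sys_group S j),
  [seq (x, rk j (i (Some x))) | x <- L j]).
(* Equal tables give a rank-preserving homomorphism [s]; then [s \o proj j] and [proj k] agree on
   the basis, hence everywhere. *)
have codeP j k : code j = code k -> forall g, rk j g = rk k g.
  move=> [/mul_table_isom[s sM srk] jk].
  suff E : (s : discrete_topology _ -> discrete_topology _) \o proj j = proj k.
    by move=> g; rewrite /rk -E /= srk.
  apply: (free_pro_unique (VS k)) => //.
  - by move=> x y /=; rewrite projM sM.
  - apply: discrete_continuous => a.
    exact: (discrete_preimage_open (s @^-1` [set a]) (projc j)).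
  have s1 : s 1 = 1 by exact: morph_mulg1.
  have half l l' x : [seq (x, rk l (i (Some x))) | x <- L l] =
      [seq (x, rk l' (i (Some x))) | x <- L l'] -> supp l x ->
      rk l (i (Some x)) = rk l' (i (Some x)).
    move=> ll'; rewrite LP /= => xL.
    have : (x, rk l (i (Some x))) \in [seq (x, rk l (i (Some x))) | x <- L l].
      by apply/mapP; exists x.
    by rewrite ll' => /mapP[y _ [<-]].
  move=> x; apply: nat_enum_rank_inj; rewrite /= srk.
  have [xj|xj] := pselect (supp j x); first exact: half.
  have [xk|xk] := pselect (supp k x); first by apply/esym; exact: half.
  move: xj xk => /contrapT xj /contrapT xk.
  by rewrite xk -[proj j _]/(proj j _) xj -srk s1.
have : [set: seq (nat * nat * nat) * seq (X * nat) * nat] #<= [set: X].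
  apply: card_setX_le => //; last exact: card_countType_le.
  apply: card_setX_le => //; first exact: card_countType_le.
  apply: card_seq_le => //; apply: card_setX_le => //.
  exact: card_countType_le.
move=> /card_leTP[e eI].
apply/card_leTP; exists (fun g => [set e (code j, rk j g) | j in [set: I]]).
move=> g h gh; apply: pI; apply/functional_extensionality_dep => j.
have : [set e (code j, rk j h) | j in [set: I]] (e (code j, rk j g)).
  by rewrite -gh; exists j.
(* The matching index [k] may differ from [j], but equal codes have equal rank functions. *)
move=> [k _ /eI kj]; move: (congr1 snd kj) => /=.
by rewrite (codeP _ _ (congr1 fst kj)) => /nat_enum_rank_inj.
Qed.

End FreePro.

(** * Families of lifts *)

Lemma card_set_le (T U : Type) :
  [set: T] #<= [set: U] -> [set: set T] #<= [set: set U].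
Proof.
move=> /card_leTP[f fI]; apply/card_leTP; exists (fun A => f @` A) => A B AB.
apply/predeqP => x; split=> Hx.
  have : (f @` B) (f x) by rewrite -AB; exists x.
  by move=> [y By /fI<-].
have : (f @` A) (f x) by rewrite AB; exists x.
by move=> [y Ay /fI<-].
Qed.

(** A function is sent to its graph, each pair [(t, a)] being coded by a subset of [X]. *)
Lemma card_fun_finType_le (X T : Type) (A : finType) :
  infinite_set [set: X] -> [set: T] #<= [set: set X] ->
  [set: T -> A] #<= [set: set (set X)].
Proof.
move=> Xinf /card_leTP[j jI].
have /card_leTP[e eI] : [set: X * nat] #<= [set: X].
  by apply: card_setX_le => //; exact: card_countType_le.
have [x0 _] := infinite_setN0 Xinf.
(* Level 0 of [X * nat] carries [j t]; the value [a] fills the level of its rank plus one, off level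
   0. *)
pose k t (a : A) : set X := [set e p | p in [set p : X * nat |
  (p.2 = 0%N /\ j t p.1) \/ p.2 = (enum_rank a).+1]].
have kE t a x n : k t a (e (x, n)) <->
    (n = 0%N /\ j t x) \/ n = (enum_rank a).+1.
  by split=> [[p pk /eI pE]|?]; [move: pk; rewrite pE|exists (x, n)].
have kI t a t' a' : k t a = k t' a' -> t = t' /\ a = a'.
  move=> kk; split.
    apply: jI; apply/predeqP => x.
    have k0 s b : k s b (e (x, 0%N)) <-> j s x.
      by split=> [/kE[[]|]//|jx]; apply/kE; left.
    split=> jx; first by apply/(k0 _ a'); rewrite -kk; apply/k0.
    by apply/(k0 _ a); rewrite kk; apply/k0.
  have : k t a (e (x0, (enum_rank a).+1)) by apply/kE; right.
  by rewrite kk => /kE[[]//|[/ord_inj/enum_rank_inj]].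
apply/card_leTP; exists (fun f => [set k t (f t) | t in [set: T]]) => f g fg.
apply/funext => t.
have : [set k t (g t) | t in [set: T]] (k t (f t)) by rewrite -fg; exists t.
by move=> [t' _ /kI[-> ->]].
Qed.

(* The sets [A_S = {t | S's trace on t.1 belongs to t.2}] form an independent
   family, as finitely many sets [S] have distinct traces on a large enough
   finite sequence. *)
Definition trace (X : Type) (S : set X) (F : seq X) : bitseq :=
  [seq `[< S x >] | x <- F].

(** Distinct sets differ at some point; [F] concatenates such points over all pairs from [L]. *)
Lemma trace_separates (X : choiceType) (L : seq (set X)) :
  exists F : seq X, forall A B, A \in L -> B \in L ->
    trace A F = trace B F -> A = B.
Proof.
have /choice[w wP] : forall p : set X * set X, exists s : seq X,
    trace p.1 s = trace p.2 s -> p.1 = p.2.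
  move=> [A B] /=; apply: contrapT => /forallNP AB.
  have /not_implyP[_] := AB [::]; apply; apply/predeqP => x.
  have /not_implyP[[xx] _] := AB [:: x].
  by split=> /asboolP Ax; apply/asboolP; [rewrite -xx|rewrite xx].
exists (flatten [seq w (A, B) | A <- L, B <- L]) => A B AL BL.
move=> /eq_in_map AB; apply: (wP (A, B)); apply/eq_in_map => x xw; apply: AB.
by apply/flattenP; exists (w (A, B)) => //; apply/allpairsP; exists (A, B).
Qed.

(** By independence any finitely many of the conditions hold at a common index, whatever the pattern
    [Phi]. *)
Lemma independent_ultra (X : choiceType) (Phi : set (set X)) :
  exists U : set_system (seq X * seq bitseq), UltraFilter U /\
    forall A, U [set t | trace A t.1 \in t.2 <-> Phi A].
Proof.
apply: finite_meet_ultra => L; have [F FP] := trace_separates L.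
(* As [F] tells the members of [L] apart, a member outside [Phi] cannot share a listed trace. *)
exists (F, [seq trace A F | A <- L & `[< Phi A >]]) => A AL /=; split.
  move=> /mapP[B]; rewrite mem_filter => /andP[/asboolP PB BL].
  by move/(FP _ _ AL BL) => ->.
by move=> PA; apply/mapP; exists A => //; rewrite mem_filter AL asboolT.
Qed.

(** The layers [f (_, n)] are disjoint, so [E] meets finitely many of them. This provides spare
    generators on which [phi] is trivial. *)
Lemma injective_avoids_finite (T U : Type) (f : T * nat -> U) (E : set U) :
  injective f -> finite_set E -> exists n, forall t, ~ E (f (t, n)).
Proof.
move=> fI Efin; apply: contrapT => /forallNP En.
apply: infinite_nat.
have fI' : {in f @^-1` E &, injective f} by move=> p q _ _; exact: fI.
apply: sub_finite_set (finite_image (@snd T nat) (finite_preimage fI' Efin)).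
by move=> n _; have /existsNP[t /contrapT Et] := En n; exists (t, n).
Qed.

(** * Lifts of [phi] through [alpha] *)

Section Lifting.
Variables (V : finite_group_class) (hV : variety_of_finite_groups V).
Variables (X : choiceType) (Xinf : infinite_set [set: X]) (G : topGroupType).
Variable i : one_point_compactification (discrete_topology X) -> G.
Hypothesis iF : is_free_pro_on V i.
Variables (C D : finGroupType) (alpha : {morphism [set: C]%SET >-> D}).
Hypothesis alpha_surj : alpha @* [set: C]%SET = [set: D]%SET.
Hypothesis VC : V [set: C]%G.
Variables (k0 : C) (k0ker : k0 \in 'ker alpha) (k01 : k0 <> 1).
Variable phi : G -> discrete_topology D.
Hypotheses (phiM : {morph phi : x y / x * y}) (phic : continuous phi).
Hypothesis phi_surj : range phi = setT.

Let Gpro : pro V G. Proof. by case: iF. Qed.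

Let alphaM : {morph alpha : x y / x * y}.
Proof. by move=> x y; rewrite morphM ?inE. Qed.

Let alpha_ker c : (alpha c == 1) = (c \in 'ker alpha).
Proof. by apply/eqP/idP => [ac|/mker//]; rewrite !inE /= ac. Qed.

Let VD : V [set: D]%G.
Proof.
apply: (variety_isog hV _ (variety_quotient hV (ker_normal alpha) VC)).
by have /= := first_isog alpha; rewrite alpha_surj.
Qed.

(** Lifting 1 to 1 keeps finite the support of a lifted family of generators. *)
Let lift_exists d : exists c, alpha c = d /\ (d = 1 -> c = 1).
Proof.
have [->|d1] := pselect (d = 1); first by exists 1; split=> //; exact: morph1.
have : d \in alpha @* [set: C]%SET by rewrite alpha_surj inE.
by move=> /morphimP[c _ _ dc]; exists c; split=> // /d1.
Qed.

(* [theta t] differs from [theta t'] only at the generators [b t] and [b t']. *)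
Lemma lift_family (T : eqType) : [set: T * nat] #<= [set: X] -> T ->
  exists (theta : T -> G -> discrete_topology C) (b : T -> G),
  [/\ forall t, {morph theta t : x y / x * y},
      forall t, continuous (theta t),
      forall t g, alpha (theta t g) = phi g,
      forall t t', theta t (b t') = if t' == t then k0 else 1 &
      forall c, c \in 'ker alpha -> exists g, forall t, theta t g = c].
Proof.
move=> TX t0.
pose E0 := [set x | phi (i (Some x)) <> 1].
have E0fin : finite_set E0 by exact: (free_pro_finite_support iF).
have : [set: T * nat * nat] #<= [set: X].
  by apply: card_setX_le => //; exact: card_countType_le.
move=> /card_leTP[e0 e0I].
have [n nE0] := injective_avoids_finite e0I E0fin.
pose e q := e0 (q, n).
have eI : injective e by move=> p q /e0I[].
have /choice[dec decP] : forall x, exists o : option (T * nat),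
    forall q, o = Some q <-> e q = x.
  move=> x; have [[q qx]|nq] := pselect (exists q, e q = x).
    exists (Some q) => q'; split=> [[<-//]|qq].
    by congr Some; apply: eI; rewrite qq.
  by exists None => q; split=> // qx; case: nq; exists q.
have deceK q : dec (e q) = Some q by apply/decP.
have /choice[lift liftP] := lift_exists.
pose kseq := enum ('ker alpha).
(* The generator [(t', 0)] singles out [t']; the generators [(t0, m.+1)] run through ['ker alpha]
   identically for all [t]. Off the layer, a fixed lift of [phi] is used. *)
pose s t x : C := if dec x is Some q then
    if q is (t', m.+1) then (if t' == t0 then nth 1 kseq m else 1)
    else if q.1 == t then k0 else 1
  else lift (phi (i (Some x))).
have kseq_ker m : nth 1 kseq m \in 'ker alpha.
  have [mk|mk] := ltnP m (size kseq); last by rewrite nth_default // group1.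
  by rewrite -mem_enum mem_nth.
have alphas t x : alpha (s t x) = phi (i (Some x)).
  rewrite /s; case E: (dec x) => [q|]; last first.
    by have [] := liftP (phi (i (Some x))).
  have -> : phi (i (Some x)) = 1.
    by apply: contrapT => x1; apply: (nE0 q); move/decP: E; rewrite /e => ->.
  apply/eqP; rewrite alpha_ker; case: q {E} => t' [|m] /=.
    by case: ifP => // _; exact: group1.
  by case: ifP => // _; exact: group1.
(* The default 1 of [nth] makes [s t] trivial at [(t0, m.+1)] once [m] exceeds the range of
   [kseq]. *)
have sfin t : finite_set [set x | s t x <> 1].
  apply: (@sub_finite_set _ _
    (E0 `|` ([set e (t, 0%N)] `|` (fun m => e (t0, m.+1)) @` `I_(size kseq)))).
    move=> x; rewrite /s /=; case E: (dec x) => [[t' [|m]]|] /=.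
    - case: eqP => // tt _; right; left; rewrite -tt.
      by apply/esym/decP.
    - case: eqP => // tt; have [mk _|mk] := ltnP m (size kseq).
        by right; right; exists m => //; apply/decP; rewrite -tt.
      by rewrite nth_default.
    - move=> lx; left => phix; apply: lx.
      by have [_ ->] := liftP (phi (i (Some x))).
  rewrite !finite_setU; split=> //; split; first exact: finite_set1.
  exact/finite_image/finite_II.
have /choice[theta thetaP] := fun t => free_pro_extend iF VC (sfin t).
exists theta, (fun t => i (Some (e (t, 0%N)))); split.
- by move=> t; have [] := thetaP t.
- by move=> t; have [] := thetaP t.
- move=> t g; have [tM tc ts] := thetaP t.
  suff : (alpha : discrete_topology C -> discrete_topology D) \o theta t = phi.
    by move=> <-.
  apply: (free_pro_unique iF VD) => //.
  + by move=> x y /=; rewrite tM alphaM.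
  + apply: discrete_continuous => a.
    exact: (discrete_preimage_open (alpha @^-1` [set a]) tc).
  + by move=> x /=; rewrite ts alphas.
- by move=> t t'; have [_ _ ->] := thetaP t; rewrite /s deceK.
- move=> c ck; exists (i (Some (e (t0, (index c kseq).+1)))) => t.
  have [_ _ ->] := thetaP t.
  by rewrite /s deceK eqxx nth_index // mem_enum.
Qed.

(* By compactness of [G], a product of infinitely many [b t] makes sense. *)
Lemma pro_interpolation (T : eqType) (theta : T -> G -> discrete_topology C)
    (b : T -> G) :
  (forall t, {morph theta t : x y / x * y}) ->
  (forall t, continuous (theta t)) ->
  (forall t t', theta t (b t') = if t' == t then k0 else 1) ->
  forall A : set T, exists g, forall t,
    theta t g = if `[< A t >] then k0 else 1.
Proof.
move=> thetaM thetac thetab A.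
pose P t := [set g | theta t g = if `[< A t >] then k0 else 1].
have [l|U [UU UP]] := @finite_meet_ultra _ _ P.
  (* Multiply the [b t] for [t] in [l] and in [A]; duplicates are removed so that each contributes
     [k0] only once. *)
  have [g gP] : exists g, forall t, theta t g =
      if (t \in undup l) && `[< A t >] then k0 else 1.
    elim: (undup l) (undup_uniq l) => [_|a s IHs /= /andP[as_ /IHs[g gP]]].
      by exists 1 => t; exact: morph_mulg1.
    exists (if `[< A a >] then b a * g else g) => t.
    rewrite inE; have [->|ta] := eqVneq t a.
      have g1 : theta a g = 1 by rewrite gP (negbTE as_).
      by rewrite orTb; case: ifP => _; rewrite ?thetaM ?g1 ?thetab ?eqxx ?mulg1.
    rewrite orFb; case: ifP => _; rewrite ?thetaM ?gP //.
    by rewrite thetab eq_sym (negbTE ta) mul1g.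
  by exists g => t tl; rewrite /P /= gP mem_undup tl.
have [g Ug] := pro_ultra_cvg Gpro UU.
exists g => t.
(* [theta t] is locally constant, so its value at the limit [g] is the one prescribed by [P t]. *)
have : U ([set h | theta t h = theta t g] `&` P t).
  apply: filterI => //; apply: Ug; apply: open_nbhs_nbhs; split=> //.
  exact: (discrete_preimage_open [set theta t g] (thetac t)).
by move=> /filter_ex[h [<-]].
Qed.

Lemma card_lifts_ge : [set: set (set X)] #<=
  [set psi : G -> C | [/\ {morph psi : x y / x * y}, range psi = setT &
                          alpha \o psi = phi]].
Proof.
(* The index set of the independent family. *)
pose T : choiceType := (seq X * seq bitseq)%type.
have TX : [set: T * nat] #<= [set: X].
  apply: card_setX_le => //; last exact: card_countType_le.
  apply: card_setX_le => //; last exact: card_countType_le.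
  exact: card_seq_le.
have [theta [b [thetaM thetac thetaphi thetab thetaker]]] :=
  lift_family TX ([::], [::]).
have /choice[U UP] := @independent_ultra X.
have UU Phi : UltraFilter (U Phi) by have [] := UP Phi.
(* The limit of [theta t g] along [U Phi] exists because [C] is finite. *)
have psi_ex (p : set (set X) * G) :
    exists c : C, U p.1 [set t | theta t p.2 = c].
  exact: (ultra_fiber (fun t => theta t p.2 : C)).
have /choice[psi psiP] := psi_ex.
(* Identities between finitely many limits are checked at one index [t]. *)
have meet Phi (P Q : set T) : U Phi P -> U Phi Q -> exists t, P t /\ Q t.
  by move=> UPP UQ; apply: (@filter_ex _ (U Phi)); exact: filterI.
have psi_const Phi g c : (forall t, theta t g = c) -> psi (Phi, g) = c.
  move=> gc; have /filter_ex[t <-] := psiP (Phi, g).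
  exact: gc.
have psiM Phi x y : psi (Phi, x * y) = psi (Phi, x) * psi (Phi, y).
  have Ux := psiP (Phi, x); have Uy := psiP (Phi, y).
  have [t [[tx ty] txy]] := meet _ _ _ (filterI Ux Uy) (psiP (Phi, x * y)).
  by rewrite -tx -ty -txy thetaM.
have psiphi Phi g : alpha (psi (Phi, g)) = phi g.
  by have /filter_ex[t <-] := psiP (Phi, g); exact: thetaphi.
have /injfunPex[f] : exists2 f : set (set X) -> G -> C,
  set_fun setT [set psi : G -> C | [/\ {morph psi : x y / x * y},
    range psi = setT & alpha \o psi = phi]] f & set_inj setT f; last first.
  exact: inj_card_le.
exists (fun Phi g => psi (Phi, g)) => [Phi _|Phi Phi' _ _ PP].
  split=> [x y|| ]; [exact: psiM| |by apply/funext => g; exact: psiphi].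
  rewrite eqEsubset; split=> // c _.
  (* A preimage of [alpha c] under [phi] reaches [c] up to a kernel element, which is the common
     value of all [theta t] at some [h]. *)
  have [g _ gc] : range phi (alpha c) by rewrite phi_surj.
  have : c * (psi (Phi, g))^-1 \in 'ker alpha.
    by rewrite -alpha_ker alphaM morphV ?inE// psiphi gc mulgV.
  move=> /thetaker[h hP]; exists (h * g) => //.
  by rewrite psiM (psi_const _ _ _ hP) mulgKV.
(* The value at an interpolating [g] decides whether [A] lies in [Phi0], so the lift determines
   [Phi0]. *)
have charP Phi0 (A : set X) (g : G) :
    (forall t, theta t g = if `[< trace A t.1 \in t.2 >] then k0 else 1) ->
    Phi0 A <-> psi (Phi0, g) = k0.
  move=> gA.
  have [t /= [<- <-]] := meet _ _ _ (psiP (Phi0, g)) ((UP Phi0).2 A).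
  rewrite gA; case: asboolP => // nA; split=> // k10.
  by case: k01.
apply/predeqP => A.
have [g gA] := pro_interpolation thetaM thetac thetab
  [set t | trace A t.1 \in t.2].
rewrite (charP Phi A g) // (charP Phi' A g) //.
by rewrite -[psi _]/((fun g => psi (Phi, g)) g) PP.
Qed.

End Lifting.

Local Close Scope card_scope.
Local Close Scope classical_set_scope.

Theorem theorem27 (V : finite_group_class) (hV : variety_of_finite_groups V)
    (M : Type) (hM : infinite_set [set: M]%classic)
    (G : topGroupType) (hG : is_free_pro_of_rank V M G)
    (K C D : finGroupType)
    (iota : {morphism [set: K] >-> C}) (alpha : {morphism [set: C] >-> D})
    (iota_inj : 'injm iota)
    (exact_C : iota @* [set: K] = 'ker alpha)
    (alpha_surj : alpha @* [set: C] = [set: D])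
    (hC : V C [set: C]%G)
    (hK : [set: K] <> 1)
    (phi : G -> D)
    (phi_morph : {morph phi : x y / x * y})
    (phi_cont : continuous (phi : G -> discrete_topology D))
    (phi_surj : range phi = [set: D]%classic) :
  ([set psi : G -> C | [/\ {morph psi : x y / x * y},
                           range psi = [set: C]
                         & alpha \o psi = phi]]
     #= [set: set (set M)])%classic%card.
Proof.
have [X XM [i iF]] := hG.
have [XleM MleX] := (card_eqPle _ _).1 XM.
have Xinf : infinite_set [set: X]%classic.
  by move=> Xfin; apply: hM; exact: card_le_finite MleX Xfin.
have [k _ k1] : exists2 k, k \in [set: K] & k != 1.
  by apply/trivgPn/eqP.
have ker_k : iota k \in 'ker alpha by rewrite -exact_C mem_morphim ?inE.
have iota_k1 : iota k <> 1.
  by move=> /eqP; rewrite morph_injm_eq1 ?inE// (negbTE k1).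
apply: Cantor_Bernstein.
  (* Upper bound: count all maps from [G] to the finite set [C]. *)
  apply: (card_le_trans (B := [set: set (set X)]%classic));
    last exact/card_set_le/card_set_le.
  apply: (card_le_trans (card_leT _)).
  exact: (card_fun_finType_le _ Xinf (card_free_pro_le iF Xinf)).
apply: (card_le_trans (B := [set: set (set X)]%classic));
  first exact/card_set_le/card_set_le.
exact: (card_lifts_ge hV Xinf iF alpha_surj hC ker_k iota_k1
  phi_morph phi_cont phi_surj).
Qed.
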